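(* Let $(p_n)_{n\ge 0}$ be the polynomials determined by $p_0(x)=1$ and $xp_n(x)=\gamma_np_{n+1}(x)+\alpha_np_{n-1}(x)$ for $n\ge 0$, where $\alpha_0=0$, $\gamma_0=1$, and $\alpha_n>0$, $\gamma_n>0$, $\alpha_n+\gamma_n=1$ for $n\ge 1$. Put $\Delta_n(x)=p_n^2(x)-p_{n-1}(x)p_{n+1}(x)$ for $n\ge1$ and $q_n(x)=\frac{p_{n+2}(x)-p_n(x)}{x^2-1}$ for $n\ge 0$. Define $\tilde q_{-1}=0$, $\tilde q_0=\gamma_1q_0=1$ and $$\tilde q_n=\frac{\gamma_1\cdots\gamma_{n+1}}{\alpha_1\cdots\alpha_n}\,q_n,\quad n\ge 1.$$ Then for all $n\ge 1$ $$\frac{\Delta_n(x)}{1-x^2}=\frac{\gamma_n}{\alpha_n}\left(\frac{\alpha_1\cdots\alpha_n}{\gamma_1\cdots\gamma_n}\right)^2\left[\tilde q_{n-1}^2(x)-\tilde q_{n-2}(x)\tilde q_n(x)\right],$$ and the polynomials $\tilde q_n$ satisfy $$x\tilde q_n=\alpha_{n+1}\tilde q_{n+1}+\gamma_{n+1}\tilde q_{n-1},\quad n\ge 0.$$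
   Context: Since $\gamma_0=1$ we have $p_n(1)=1$ and $p_n(-1)=(-1)^n$, so $p_{n+2}-p_n$ and $\Delta_n$ are divisible by $x^2-1$; hence $q_n$ and $\Delta_n(x)/(1-x^2)$ are polynomials. *)

(* Defs.v *)
From mathcomp Require Import all_boot all_order all_algebra.

Set Implicit Arguments.
Unset Strict Implicit.
Unset Printing Implicit Defensive.

Import Order.TTheory GRing.Theory Num.Theory.

Local Open Scope ring_scope.

(* Only used for 1 <= n, where n.-1 is the true predecessor. *)
Definition turan (R : fieldType) (p : nat -> {poly R}) (n : nat) : {poly R} :=
  p n ^+ 2 - p n.-1 * p n.+1.

(* %/ is Euclidean division; it is the exact quotient whenever the divisor
   divides the numerator, which the theorem asserts for all n. *)
Definition diffq (R : fieldType) (p : nat -> {poly R}) (n : nat) : {poly R} :=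
  (p n.+2 - p n) %/ ('X^2 - 1).

(* Indexed by int so that the index -1 is available (the value is 0 there and,
   as a junk value, at all smaller indices).  For n = 0 the denominator is an
   empty product, so the coefficient is gamma 1. *)
Definition diffq_tilde (R : fieldType) (alpha gamma : nat -> R)
    (p : nat -> {poly R}) (m : int) : {poly R} :=
  match m with
  | Posz n =>
      ((\prod_(1 <= i < n.+2) gamma i) / (\prod_(1 <= i < n.+1) alpha i))
        *: diffq p n
  | Negz _ => 0
  end.

(* Main.v *)
Require Import Defs.
From mathcomp Require Import all_boot all_order all_algebra.
From mathcomp Require Import ring.

Set Implicit Arguments.
Unset Strict Implicit.
Unset Printing Implicit Defensive.

Import Order.TTheory GRing.Theory Num.Theory.

Local Open Scope ring_scope.

(** Since alpha_n + gamma_n = 1, the recurrence rewrites as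
      alpha_n (p_{n+1} - p_{n-1}) = p_{n+1} - x p_n,
      gamma_n (p_{n+1} - p_{n-1}) = x p_n - p_{n-1}.
    Combining the two at consecutive indices gives
      gamma_{n+2} (p_{n+3} - p_{n+1})
        = alpha_{n+1} x (p_{n+2} - p_n) + (x^2 - 1) p_{n+1},
    whence divisibility by x^2 - 1.  The recurrence
      x q_n = gamma_{n+2} q_{n+1} + alpha_n q_{n-1}
    and the identity
      Delta_n / (1 - x^2)
        = gamma_n alpha_n q_{n-1}^2 - alpha_{n-1} gamma_{n+1} q_{n-2} q_n
    are then linear and quadratic consequences, respectively, of the first two
    identities; rescaling q to tilde q gives the theorem. *)

(* The index shift q_{n-1}, with q_{-1} = 0. *)
Definition diffq_pred (R : fieldType) (p : nat -> {poly R}) (n : nat) :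
    {poly R} :=
  if n is m.+1 then diffq p m else 0.

(* The ratio of tilde q_{n-1} to q_{n-1}. *)
Definition tilde_coef (R : fieldType) (alpha gamma : nat -> R) (n : nat) : R :=
  (\prod_(1 <= i < n.+1) gamma i) / (\prod_(1 <= i < n) alpha i).

Lemma X2sub1_neq0 (R : fieldType) : 'X^2 - 1 != 0 :> {poly R}.
Proof. by rewrite -size_poly_eq0 size_XnsubC. Qed.

Lemma diffq_tilde_subz1 (R : fieldType) (alpha gamma : nat -> R)
    (p : nat -> {poly R}) (n : nat) :
  diffq_tilde alpha gamma p (n%:Z - 1) =
    tilde_coef alpha gamma n *: diffq_pred p n.
Proof.
case: n => [|n]; first by rewrite scaler0.
by rewrite -addn1 PoszD addrK addn1.
Qed.

(** This exchange is what swaps the roles of alpha and gamma when the recurrence for q is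
    rescaled. *)
Lemma tilde_coefS (R : fieldType) (alpha gamma : nat -> R) (n : nat) :
  alpha n.+1 != 0 ->
  alpha n.+1 * tilde_coef alpha gamma n.+2 =
    gamma n.+2 * tilde_coef alpha gamma n.+1.
Proof.
move=> an0.
rewrite /tilde_coef (big_nat_recr n.+2 _ gamma) //=.
rewrite (big_nat_recr n.+1 _ alpha) //=.
(* With the inverse product kept opaque, only [alpha n.+1] has to be nonzero. *)
by rewrite invfM; set A := (\prod_(1 <= i < n.+1) alpha i)^-1; field.
Qed.

(** The prefactor of the theorem undoes the rescaling of the squared term, leaving its coefficient
    in the identity for the unscaled q. *)
Lemma tilde_coef_sqr (R : fieldType) (alpha gamma : nat -> R) (n : nat) :
  (forall i, (1 <= i)%N -> alpha i != 0) ->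
  (forall i, (1 <= i)%N -> gamma i != 0) ->
  gamma n.+1 / alpha n.+1 *
    ((\prod_(1 <= i < n.+2) alpha i) / (\prod_(1 <= i < n.+2) gamma i)) ^+ 2 *
    tilde_coef alpha gamma n.+1 ^+ 2 = gamma n.+1 * alpha n.+1.
Proof.
move=> alpha_neq0 gamma_neq0.
rewrite /tilde_coef (big_nat_recr n.+1 _ alpha) //=.
have A0 : \prod_(1 <= i < n.+1) alpha i != 0.
  rewrite prodf_seq_neq0; apply/allP => i; rewrite mem_index_iota.
  by case/andP=> i1 _; apply: alpha_neq0.
have G0 : \prod_(1 <= i < n.+2) gamma i != 0.
  rewrite prodf_seq_neq0; apply/allP => i; rewrite mem_index_iota.
  by case/andP=> i1 _; apply: gamma_neq0.
have an0 := alpha_neq0 n.+1 isT.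
by field; rewrite A0 G0 an0.
Qed.

Lemma alpha_diff (R : fieldType) (alpha gamma : nat -> R)
    (p : nat -> {poly R}) (n : nat) :
  alpha n + gamma n = 1 ->
  'X * p n = gamma n *: p n.+1 + alpha n *: p n.-1 ->
  alpha n *: (p n.+1 - p n.-1) = p n.+1 - 'X * p n.
Proof.
by move=> ag ->; rewrite -{2}[p n.+1]scale1r -ag -!mul_polyC polyCD; ring.
Qed.

Lemma gamma_diff (R : fieldType) (alpha gamma : nat -> R)
    (p : nat -> {poly R}) (n : nat) :
  alpha n + gamma n = 1 ->
  'X * p n = gamma n *: p n.+1 + alpha n *: p n.-1 ->
  gamma n *: (p n.+1 - p n.-1) = 'X * p n - p n.-1.
Proof.
by move=> ag ->; rewrite -{3}[p n.-1]scale1r -ag -!mul_polyC polyCD; ring.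
Qed.

Lemma dvdp_diff (R : fieldType) (alpha gamma : nat -> R)
    (p : nat -> {poly R}) :
  alpha 0%N = 0 -> gamma 0%N = 1 ->
  (forall n, (1 <= n)%N -> gamma n != 0) ->
  (forall n, (1 <= n)%N -> alpha n + gamma n = 1) ->
  p 0%N = 1 ->
  (forall n, 'X * p n = gamma n *: p n.+1 + alpha n *: p n.-1) ->
  forall n, ('X^2 - 1) %| (p n.+2 - p n).
Proof.
move=> alpha0 gamma0 gamma_neq0 ag p0 p_rec.
elim=> [|n IHn].
  rewrite -(dvdpZr _ _ (gamma_neq0 1 isT)).
  rewrite (gamma_diff (n := 1) (ag 1 isT) (p_rec 1%N)) /= p0.
  move: (p_rec 0%N); rewrite alpha0 gamma0 scale0r addr0 scale1r p0 mulr1 => <-.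
  by rewrite -expr2.
rewrite -(dvdpZr _ _ (gamma_neq0 n.+2 isT)).
rewrite (gamma_diff (n := n.+2) (ag n.+2 isT) (p_rec n.+2)) /=.
(* The bracket multiplied by x is [alpha n.+1 *: (p n.+2 - p n)], to which the induction hypothesis
   applies. *)
have -> : 'X * p n.+2 - p n.+1 =
    'X * (p n.+2 - 'X * p n.+1) + ('X^2 - 1) * p n.+1 by ring.
rewrite -(alpha_diff (n := n.+1) (ag n.+1 isT) (p_rec n.+1)) /=.
rewrite -mul_polyC; apply: dvdp_add; last exact: dvdp_mulr.
by do 2!apply: dvdp_mull.
Qed.

Theorem mainTheorem2 (R : realFieldType) (alpha gamma : nat -> R)
    (p : nat -> {poly R})
    (alpha0 : alpha 0%N = 0) (gamma0 : gamma 0%N = 1)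
    (alpha_gt0 : forall n : nat, (1 <= n)%N -> 0 < alpha n)
    (gamma_gt0 : forall n : nat, (1 <= n)%N -> 0 < gamma n)
    (alphaDgamma : forall n : nat, (1 <= n)%N -> alpha n + gamma n = 1)
    (p0 : p 0%N = 1)
    (* at n = 0 the last term vanishes, since alpha 0 = 0 *)
    (p_rec : forall n : nat,
       'X * p n = gamma n *: p n.+1 + alpha n *: p n.-1) :
  let qt := diffq_tilde alpha gamma p in
  [/\ forall n : nat, ('X^2 - 1) %| (p n.+2 - p n),
      gamma 1%N *: diffq p 0 = 1 /\ qt 0 = 1,
      forall n : nat, (1 <= n)%N ->
        (1 - 'X^2) %| turan p n /\
        turan p n %/ (1 - 'X^2) =
          (gamma n / alpha n *
           ((\prod_(1 <= i < n.+1) alpha i) /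
            (\prod_(1 <= i < n.+1) gamma i)) ^+ 2)
          *: (qt (n%:Z - 1) ^+ 2 - qt (n%:Z - 2) * qt n%:Z)
    & forall n : nat,
        'X * qt n%:Z =
          alpha n.+1 *: qt (n%:Z + 1) + gamma n.+1 *: qt (n%:Z - 1)].
Proof.
have alpha_neq0 n : (1 <= n)%N -> alpha n != 0 by move/alpha_gt0/lt0r_neq0.
have gamma_neq0 n : (1 <= n)%N -> gamma n != 0 by move/gamma_gt0/lt0r_neq0.
have dvd := dvdp_diff alpha0 gamma0 gamma_neq0 alphaDgamma p0 p_rec.
have qE n : diffq p n * ('X^2 - 1) = p n.+2 - p n by rewrite divpK.
have p1 : p 1%N = 'X.
  by move: (p_rec 0%N); rewrite alpha0 gamma0 scale0r addr0 scale1r p0 mulr1.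
have w0 := X2sub1_neq0 R.
have aq n : (alpha n)%:P * diffq_pred p n * ('X^2 - 1) = p n.+1 - 'X * p n.
  (* At index 0 both sides vanish: q_{-1} = 0 and p_1 = x p_0. *)
  case: n => [|n]; first by rewrite mulr0 mul0r p0 p1 mulr1 subrr.
  by rewrite -mulrA qE mul_polyC
    (alpha_diff (alphaDgamma n.+1 isT) (p_rec n.+1)).
have gq n : (gamma n.+1)%:P * diffq_pred p n.+1 * ('X^2 - 1) =
    'X * p n.+1 - p n.
  by rewrite -mulrA qE mul_polyC
    (gamma_diff (alphaDgamma n.+1 isT) (p_rec n.+1)).
have q0 : gamma 1%N *: diffq p 0%N = 1.
  apply: (mulIf w0); have := gq 0%N; rewrite mul_polyC => ->.
  by rewrite p0 p1 mul1r -expr2.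
have qrec n : 'X * diffq_pred p n.+1 =
    (gamma n.+2)%:P * diffq_pred p n.+2 + (alpha n)%:P * diffq_pred p n.
  (* In the sum of [gq n.+1] and [aq n] the terms [p n.+1] cancel, leaving x (p_{n+2} - p_n). *)
  by apply: (mulIf w0); rewrite mulrDl gq aq -mulrA qE; ring.
have turanE n : turan p n.+1 =
    ((gamma n.+1 * alpha n.+1)%:P * diffq_pred p n.+1 ^+ 2 -
     (alpha n)%:P * (gamma n.+2)%:P * (diffq_pred p n * diffq_pred p n.+2))
    * (1 - 'X^2).
  (* One factor x^2 - 1 for each q in a product: [gq] and [aq] then leave an identity in x, p_n,
     p_{n+1}, p_{n+2}. *)
  apply: (mulIf w0); apply: (mulIf w0).
  transitivity ((1 - 'X^2) * ('X^2 - 1) *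
    ((gamma n.+1)%:P * diffq_pred p n.+1 * ('X^2 - 1) *
       ((alpha n.+1)%:P * diffq_pred p n.+1) -
     (alpha n)%:P * diffq_pred p n * ('X^2 - 1) *
       ((gamma n.+2)%:P * diffq_pred p n.+2))).
    rewrite -[RHS]mulrA.
    have -> (a b c d : {poly R}) : ('X^2 - 1) * (a * b - c * d) =
      a * (b * ('X^2 - 1)) - c * (d * ('X^2 - 1)) by ring.
    by rewrite !gq !aq /turan /=; ring.
  by rewrite polyCM; ring.
move=> qt.
have qtS n : qt n%:Z = tilde_coef alpha gamma n.+1 *: diffq_pred p n.+1 by [].
split=> //.
- by split=> //; rewrite qtS /tilde_coef big_nat1 big_geq // divr1.
- case=> // n _; have nz : 1 - 'X^2 != 0 :> {poly R} by rewrite -opprB oppr_eq0.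
  rewrite turanE dvdp_mulIr mulpK //; split=> //.
  have -> : n.+1%:Z - 2 = n%:Z - 1 by rewrite -addn1 PoszD; ring.
  rewrite /qt !diffq_tilde_subz1 -/qt qtS.
  set K := _ / _ * _.
  have KE : K * tilde_coef alpha gamma n.+1 ^+ 2 = gamma n.+1 * alpha n.+1.
    exact: tilde_coef_sqr.
  (* The scalars alone differ at n = 0, where [alpha 0 = 0] but [tilde_coef] is 1; the factor q_{-1}
     = 0 rescues the equality. *)
  have KcE : (K * tilde_coef alpha gamma n * tilde_coef alpha gamma n.+2) *:
      (diffq_pred p n * diffq_pred p n.+2) =
      (alpha n * gamma n.+2) *: (diffq_pred p n * diffq_pred p n.+2).
    case: n @K KE => [|n] K KE; first by rewrite mul0r !scaler0.
    congr (_ *: _); set c := tilde_coef alpha gamma in KE *.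
    have an := alpha_neq0 n.+2 isT; have gn := gamma_neq0 n.+2 isT.
    (* These two factors let [tilde_coefS] bring both outer coefficients to the middle one, so that
       [KE] applies. *)
    apply: (mulIf (mulf_neq0 gn an)).
    transitivity (K * (gamma n.+2 * c n.+1) * (alpha n.+2 * c n.+3)).
      by ring.
    rewrite (tilde_coefS gamma an) -(tilde_coefS gamma (alpha_neq0 n.+1 isT)).
    transitivity (K * c n.+2 ^+ 2 * alpha n.+1 * gamma n.+3).
      by rewrite /c; ring.
    by rewrite KE; ring.
  rewrite scalerBr exprZn scalerA KE -!scalerAl -!scalerAr !scalerA KcE.
  by rewrite -!mul_polyC !polyCM.
- move=> n; rewrite -[n%:Z + 1]/(Posz (n + 1)) addn1 !qtS.
  rewrite /qt diffq_tilde_subz1 scalerA tilde_coefS ?alpha_neq0 //.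
  rewrite -scalerAr qrec.
  (* The exchange of coefficients starts at index 1; at n = 0 the q_{-1} terms are zero on both
     sides. *)
  case: n => [|n]; first by rewrite /= alpha0 !(mulr0, scaler0, addr0)
    mul_polyC scalerA mulrC.
  rewrite scalerDr !mul_polyC !scalerA.
  rewrite -(tilde_coefS gamma (alpha_neq0 n.+1 isT)).
  by congr (_ *: _ + _ *: _); rewrite mulrC.
Qed.
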